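(* Let $q\ge3$ be a prime power, let $C\le\mathbb{F}_q^n$ be a linear code of dimension $k$, and let $0\le i\le k$. Then $C$ is $i$-BMD if and only if $C$ is $i$-MDS.
   Context: For $c\in\mathbb{F}_q^n$, $\operatorname{wt}(c)=|\{s: c_s\ne0\}|$ is the Hamming weight. An optimal linear anticode is a subspace $A\le\mathbb{F}_q^n$ with $\dim_{\mathbb{F}_q}(A)=\max\{\operatorname{wt}(a):a\in A\}$. The $i$-th generalized weight of $C$ is $d_i(C)=\min\{\dim_{\mathbb{F}_q}(A): A \text{ an optimal linear anticode in } \mathbb{F}_q^n,\ \dim_{\mathbb{F}_q}(C\cap A)\ge i\}$. $C^\perp$ is the dual code with respect to the standard inner product, and $d^\perp$ is its minimum Hamming distance (minimum weight of a nonzero codeword), with $d^\perp=n+1$ if $C^\perp=\{0\}$. $C$ is $i$-BMD if $n-d^\perp-d_i(C)<0$. $C$ is $i$-MDS if $d_i(C)=n-k+i$. *)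

(* Defs.v *)
From HB Require Import structures.
From mathcomp Require Import all_boot all_order all_algebra.
Set Implicit Arguments.
Unset Strict Implicit.
Unset Printing Implicit Defensive.
Import Order.TTheory GRing.Theory Num.Theory.
Local Open Scope ring_scope.

(* The finitely many subspaces, so that minima over them can be taken. *)
HB.instance Definition _ (F : finFieldType) (vT : vectType F) :
    Choice_isCountable {vspace vT} :=
  Choice_isCountable.Build {vspace vT}
    (pcan_pickleK (can_pcan (@VectorInternalTheory.vs2mxK F vT))).
HB.instance Definition _ (F : finFieldType) (vT : vectType F) :
    isFinite {vspace vT} := CanIsFinite (@VectorInternalTheory.vs2mxK F vT).

Definition wt (F : finFieldType) (n : nat) (c : 'rV[F]_n) : nat :=
  #|[set s : 'I_n | c 0 s != 0]|.

Definition optimal_anticode (F : finFieldType) (n : nat)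
    (A : {vspace 'rV[F]_n}) : bool :=
  (\dim A == \max_(a : 'rV[F]_n | a \in A) wt a)%N.

(* The whole space is an optimal anticode, so for i <= \dim C the start value
   fullv is admissible and this is a true minimum (gen_weightP below); for
   i > \dim C the value n is junk. *)
Definition gen_weight (F : finFieldType) (n : nat) (C : {vspace 'rV[F]_n})
    (i : nat) : nat :=
  \dim [arg min_(A < fullv : {vspace 'rV[F]_n} |
          optimal_anticode A && (i <= \dim (C :&: A))%N) \dim A].

Definition dual_code (F : finFieldType) (n : nat) (C : {vspace 'rV[F]_n}) :
    {vspace 'rV[F]_n} :=
  (\bigcap_(c : 'rV[F]_n | c \in C) lker (linfun (mulmxr c^T)))%VS.

(* Weights are at most n, so the default value n.+1 is taken exactly when
   D = 0 (min_distP below). *)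
Definition min_dist (F : finFieldType) (n : nat) (D : {vspace 'rV[F]_n}) : nat :=
  \big[minn/n.+1]_(c : 'rV[F]_n | (c \in D) && (c != 0)) wt c.

Definition BMD (F : finFieldType) (n : nat) (C : {vspace 'rV[F]_n})
    (i : nat) : Prop :=
  n%:Z - (min_dist (dual_code C))%:Z - (gen_weight C i)%:Z < 0.

Definition MDS (F : finFieldType) (n : nat) (C : {vspace 'rV[F]_n})
    (i : nat) : Prop :=
  (gen_weight C i)%:Z = n%:Z - (\dim C)%:Z + i%:Z.

Lemma wt_le (F : finFieldType) (n : nat) (c : 'rV[F]_n) : (wt c <= n)%N.
Proof. by rewrite -[X in (_ <= X)%N]card_ord; exact: max_card. Qed.

Lemma fullv_optimal (F : finFieldType) (n : nat) :
  optimal_anticode (fullv : {vspace 'rV[F]_n}).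
Proof.
rewrite /optimal_anticode dimvf /dim /= mul1n eqn_leq; apply/andP; split.
  have wt1 : wt (const_mx 1 : 'rV[F]_n) = n.
    rewrite /wt -[RHS]card_ord; apply: eq_card => s.
    by rewrite !inE mxE oner_eq0.
  rewrite -{1}wt1; apply: (@leq_bigmax_cond _ _ (@wt F n)).
  by rewrite memvf.
by apply/bigmax_leqP => a _; exact: wt_le.
Qed.

Lemma gen_weightP (F : finFieldType) (n : nat) (C : {vspace 'rV[F]_n})
    (i : nat) (hi : (i <= \dim C)%N) :
  (exists A : {vspace 'rV[F]_n}, [/\ optimal_anticode A,
      (i <= \dim (C :&: A))%N & gen_weight C i = \dim A]) /\
  (forall A : {vspace 'rV[F]_n}, optimal_anticode A ->
      (i <= \dim (C :&: A))%N -> (gen_weight C i <= \dim A)%N).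
Proof.
rewrite /gen_weight; case: arg_minnP => [|A /andP[oA iA] minA].
  by rewrite fullv_optimal capvf.
by split=> [|B oB iB]; [exists A | apply: minA; rewrite oB iB].
Qed.

Lemma mem_dual_code (F : finFieldType) (n : nat) (C : {vspace 'rV[F]_n})
    (x : 'rV[F]_n) :
  reflect (forall c : 'rV[F]_n, c \in C -> \sum_(s < n) x 0 s * c 0 s = 0)
          (x \in dual_code C).
Proof.
have E (c : 'rV[F]_n) : (x \in lker (linfun (mulmxr c^T)))
           = (\sum_(s < n) x 0 s * c 0 s == 0).
  rewrite memv_ker lfunE /=; apply/eqP/eqP => [/matrixP/(_ 0 0)|xc].
    by rewrite !mxE => xc; rewrite -[RHS]xc; apply: eq_bigr => s _; rewrite mxE.
  apply/matrixP => a b; rewrite !ord1 !mxE -[RHS]xc.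
  by apply: eq_bigr => s _; rewrite mxE.
rewrite memvE; apply: (iffP subv_bigcapP) => h c /h; rewrite -memvE E.
  by move/eqP.
by move=> ->.
Qed.

Lemma min_dist_le (F : finFieldType) (n : nat) (D : {vspace 'rV[F]_n})
    (c : 'rV[F]_n) : c \in D -> c != 0 -> (min_dist D <= wt c)%N.
Proof.
move=> cD c0; rewrite /min_dist.
elim: index_enum (mem_index_enum c) => // d r IH; rewrite inE big_cons.
case/predU1P => [<-|/IH le_r]; first by rewrite cD c0 geq_minl.
by case: ifP => // _; apply: leq_trans (geq_minr _ _) le_r.
Qed.

Lemma min_distP (F : finFieldType) (n : nat) (D : {vspace 'rV[F]_n}) :
  (D = 0%VS -> min_dist D = n.+1) /\
  (D <> 0%VS ->
    (exists c : 'rV[F]_n, [/\ c \in D, c != 0 & min_dist D = wt c]) /\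
    (forall c : 'rV[F]_n, c \in D -> c != 0 -> (min_dist D <= wt c)%N)).
Proof.
rewrite /min_dist; split=> [->|/eqP D0].
  by apply: big_pred0 => c; rewrite memv0 andbN.
split=> [|c cD c0]; last exact: min_dist_le.
have P0 : (vpick D \in D) && (vpick D != 0) by rewrite memv_pick vpick0.
case: (@arg_minnP _ (vpick D) (fun c => (c \in D) && (c != 0)) (@wt F n) P0) => c /andP[cD c0] minc.
exists c; split=> //; apply/eqP; rewrite eqn_leq; apply/andP; split.
  exact: min_dist_le.
elim/big_ind: _ => [|x y hx hy|d]; first exact/leqW/wt_le.
  by rewrite leq_min hx.
exact: minc.
Qed.

(* Main.v *)
(* For q >= 3 the optimal anticodes are exactly the coordinate subspaces
   F^S: choose a coordinate complement F^T of the anticode A; a word of A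
   without zeros off T already has weight \dim A, hence vanishes on T, and for
   q >= 3 every word of A is a difference of two such words.  So d_i(C) is the
   least |S| with \dim (C :&: F^S) >= i.  Finally \dim (C :&: F^S) exceeds
   k + |S| - n exactly when C + F^S is proper, i.e. when C^\perp has a nonzero
   word supported off S, and this compares d_i(C) with d^\perp. *)
Require Import Defs.
From mathcomp Require Import all_boot all_order all_algebra.
From mathcomp Require Import zify.
Import Order.TTheory GRing.Theory Num.Theory.
Local Open Scope ring_scope.

(** * Coordinate subspaces $F^S$ *)

Definition coord_space (F : finFieldType) (n : nat) (S : {set 'I_n}) :
    {vspace 'rV[F]_n} :=
  span [seq delta_mx 0 s | s <- enum S].

Lemma delta_coord_space (F : finFieldType) (n : nat) (S : {set 'I_n}) s :
  s \in S -> delta_mx 0 s \in coord_space F n S.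
Proof. by move=> sS; apply/memv_span/map_f; rewrite mem_enum. Qed.

Lemma coord_spaceP (F : finFieldType) (n : nat) (S : {set 'I_n})
    (v : 'rV[F]_n) :
  reflect (forall s, s \notin S -> v 0 s = 0) (v \in coord_space F n S).
Proof.
apply: (iffP idP) => [vS s sS | vS].
  rewrite (coord_span vS) summxE big1 // => j _; rewrite mxE.
  have /mapP[t] : [seq (delta_mx 0 s : 'rV[F]_n) | s <- enum S]`_j \in
      [seq delta_mx 0 s | s <- enum S]
    by apply: mem_nth; rewrite size_map -cardE; exact: ltn_ord.
  rewrite mem_enum /= => tS ->; rewrite mxE eqxx /=.
  by case: eqP => [st|]; rewrite ?mulr0 //; rewrite st tS in sS.
rewrite [v]row_sum_delta; apply: memv_suml => s _.
have [sS | /vS ->] := boolP (s \in S); last by rewrite scale0r mem0v.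
exact/memvZ/delta_coord_space.
Qed.

Lemma delta_fullv (F : finFieldType) (n : nat) (U : {vspace 'rV[F]_n}) :
  (forall s, delta_mx 0 s \in U) -> U = fullv.
Proof.
move=> dU; apply/eqP; rewrite eqEsubv subvf; apply/subvP => v _.
by rewrite [v]row_sum_delta; apply: memv_suml => s _; apply: memvZ.
Qed.

Lemma dim_rowvf (F : finFieldType) (n : nat) :
  \dim (fullv : {vspace 'rV[F]_n}) = n.
Proof. by rewrite dimvf /dim /= mul1n. Qed.

Lemma dim_coord_space (F : finFieldType) (n : nat) (S : {set 'I_n}) :
  \dim (coord_space F n S) = #|S|.
Proof.
have leS (T : {set 'I_n}) : (\dim (coord_space F n T) <= #|T|)%N.
  by apply: leq_trans (dim_span _) _; rewrite size_map cardE.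
apply/eqP; rewrite eqn_leq leS /= -(leq_add2r #|~: S|) cardsC card_ord.
(* The upper bounds $|S|$ and $|S^c|$ add up to $n$, so it is enough that $F^S$ and $F^{S^c}$
   together span the whole space. *)
have SCf : (coord_space F n S + coord_space F n (~: S))%VS = fullv.
  apply: delta_fullv => s; have [sS | sS] := boolP (s \in S).
    exact: subvP (addvSl _ _) _ (delta_coord_space F n S s sS).
  apply: subvP (addvSr _ _) _ (delta_coord_space F n (~: S) s _).
  by rewrite inE.
rewrite -[leqLHS](dim_rowvf F) -SCf.
by apply: leq_trans (dimv_add_leqif _ _) _; rewrite leq_add2l leS.
Qed.

Lemma wt_coord_space (F : finFieldType) (n : nat) (S : {set 'I_n})
    (v : 'rV[F]_n) :
  v \in coord_space F n S -> (wt v <= #|S|)%N.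
Proof.
move/coord_spaceP => vS; apply/subset_leq_card/subsetP => s; rewrite inE.
by apply: contraNT => /vS ->.
Qed.

Lemma coord_space_optimal (F : finFieldType) (n : nat) (S : {set 'I_n}) :
  optimal_anticode (coord_space F n S).
Proof.
rewrite /optimal_anticode dim_coord_space eqn_leq.
apply/andP; split; last first.
  by apply/bigmax_leqP => a; exact: wt_coord_space.
pose o : 'rV[F]_n := \row_s (s \in S)%:R.
have <- : wt o = #|S|.
  by apply: eq_card => s; rewrite !inE mxE; case: (s \in S);
    rewrite ?oner_eq0 ?eqxx.
apply: (@leq_bigmax_cond _ _ (@wt F n)).
by apply/coord_spaceP => s /negbTE sS; rewrite mxE sS.
Qed.

(** * Classification of the optimal anticodes for $q\ge3$ *)

Lemma coord_complement (F : finFieldType) (n : nat) (A : {vspace 'rV[F]_n}) :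
  exists T, (A :&: coord_space F n T = 0)%VS /\
            (A + coord_space F n T = fullv)%VS.
Proof.
pose P T := (A :&: coord_space F n T == 0)%VS.
have P0 : P set0.
  apply/eqP; rewrite (_ : coord_space F n set0 = 0%VS) ?capv0 //.
  by apply/eqP; rewrite -dimv_eq0 dim_coord_space cards0.
(* Take $T$ of maximal size with $A\cap F^T=0$. If some $e_j$ were outside $A+F^T$, then
   $T\cup\{j\}$ would still meet $A$ trivially. *)
have [T PT maxT] := @arg_maxnP _ set0 P (fun T => #|T|) P0.
exists T; split; first exact/eqP.
apply: delta_fullv => j; apply/negPn/negP => jAT.
have jT : j \notin T.
  apply: contra jAT => jT; apply: subvP (addvSr _ _) _ _.
  exact: delta_coord_space.
have : P (j |: T).
  rewrite /P -subv0; apply/subvP => v; rewrite memv_cap => /andP[vA].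
  move/coord_spaceP => vT; pose w := v - v 0 j *: delta_mx 0 j.
  have wT : w \in coord_space F n T.
    apply/coord_spaceP => s sT; rewrite !mxE eqxx /=.
    have [-> | sj] := eqVneq s j; first by rewrite mulr1 subrr.
    by rewrite mulr0 subr0 vT // !inE negb_or sj.
  have [vj0 | vj0] := eqVneq (v 0 j) 0.
    have wv : w = v by rewrite /w vj0 scale0r subr0.
    by rewrite -(eqP PT) memv_cap vA -wv.
  (* Here $v\in A$ and $w\in F^T$ differ by a nonzero multiple of $e_j$, which puts $e_j$ into
     $A+F^T$. *)
  case/negP: jAT.
  have -> : delta_mx 0 j = (v 0 j)^-1 *: (v - w).
    by rewrite /w opprB addrC subrK scalerA mulVf ?scale1r.
  by rewrite memvZ // memv_add // memvN.
by move/maxT; rewrite cardsU1 jT /= add1n ltnn.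
Qed.

(** Only the values $0$ and $-x$ have to be avoided; this is where $q\ge3$ enters. *)
Lemma exists_nonzero_shift (F : finFieldType) (x : F) :
  (3 <= #|F|)%N -> exists y, (y != 0) && (x + y != 0).
Proof.
move=> hq; have /card_gt0P[y] : (0 < #|~: [set 0%R; (- x)%R]|)%N.
  rewrite -(ltn_add2l #|[set 0%R; (- x)%R]|) addn0 cardsC.
  by apply: leq_trans hq; rewrite cards2; case: (_ != _).
rewrite !inE negb_or => /andP[y0 yx]; exists y.
by rewrite y0 addrC addr_eq0.
Qed.

Lemma optimal_coord_space (F : finFieldType) (n : nat)
    (A : {vspace 'rV[F]_n}) :
  (3 <= #|F|)%N -> optimal_anticode A -> exists S, A = coord_space F n S.
Proof.
move=> hq /eqP dA; have [T [AT0 ATf]] := coord_complement F n A.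
have dT : (\dim A = #|~: T|)%N.
  apply/eqP; rewrite -(eqn_add2r #|T|) [(#|~: T| + _)%N]addnC cardsC card_ord.
  by rewrite -(dim_coord_space F) -dimv_disjoint_sum // ATf dim_rowvf.
(* The complement of $T$ already contributes $\dim A$ to the weight of [b]; one more nonzero entry
   would exceed the maximum weight in $A$. *)
have nz b : b \in A -> (forall s, s \notin T -> b 0 s != 0) ->
    forall s, s \in T -> b 0 s = 0.
  move=> bA bT s sT; apply/eqP/negPn/negP => bs.
  have : (wt b <= \dim A)%N.
    by rewrite dA; apply: (@leq_bigmax_cond _ _ (@wt F n)).
  rewrite dT leqNgt; case/negP; apply: proper_card.
  apply/properP; split; last by exists s; rewrite !inE ?sT.
  by apply/subsetP => t; rewrite !inE; exact: bT.
exists (~: T); apply/eqP; rewrite eqEdim dim_coord_space dT leqnn andbT.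
apply/subvP => a aA; apply/coord_spaceP => s; rewrite inE negbK => sT.
(* Neither [m] nor [a + m] has a zero entry. The $A$-component [b] of [m] agrees with [m] off $T$,
   so [nz] applies to both [b] and [a + b], and [a] is their difference. *)
pose m : 'rV[F]_n := \row_s xchoose (exists_nonzero_shift F (a 0 s) hq).
have : m \in (A + coord_space F n T)%VS by rewrite ATf memvf.
case/memv_addP => b bA [t /coord_spaceP tT mE].
have bm u : u \notin T -> b 0 u = m 0 u.
  by move=> uT; rewrite mE mxE tT // addr0.
have mP u : (m 0 u != 0) && (a 0 u + m 0 u != 0).
  by rewrite mxE; apply: (xchooseP (exists_nonzero_shift F (a 0 u) hq)).
have b0 : b 0 s = 0.
  by apply: nz => // u uT; rewrite bm //; case/andP: (mP u).
have : (a + b) 0 s = 0.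
  apply: nz => // [|u uT]; first exact: memvD.
  by rewrite mxE bm //; case/andP: (mP u).
by rewrite mxE b0 addr0.
Qed.

(** * Generalized weights as minima over coordinate sets *)

Lemma gen_weight_coordP (F : finFieldType) (n i : nat)
    (C : {vspace 'rV[F]_n}) :
  (3 <= #|F|)%N -> (i <= \dim C)%N ->
  (exists2 S : {set 'I_n}, gen_weight C i = #|S| &
     (i <= \dim (C :&: coord_space F n S))%N) /\
  (forall S, (i <= \dim (C :&: coord_space F n S))%N ->
     (gen_weight C i <= #|S|)%N).
Proof.
move=> hq /gen_weightP[[A [oA iA gA]] minA]; split.
  have [S AS] := optimal_coord_space F n A hq oA.
  by exists S; rewrite -?AS // gA AS dim_coord_space.
move=> S /(minA _ (coord_space_optimal F n S)).
by rewrite dim_coord_space.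
Qed.

(** * Proper sums $C+F^S$ and dual words *)

Lemma proper_orthogonal (F : finFieldType) (n : nat) (U : {vspace 'rV[F]_n}) :
  U != fullv ->
  exists2 c : 'rV[F]_n, c != 0 & forall x, x \in U -> \sum_s c 0 s * x 0 s = 0.
Proof.
move=> Uf; have [v vU] : exists v, v \notin U.
  apply/existsP; apply: contraR Uf; rewrite negb_exists => /forallP h.
  by apply/eqP/delta_fullv => s; have := h (delta_mx 0 s); rewrite negbK.
(* The map [f] kills exactly $U$, so some coordinate $j$ of [f] is a nonzero functional vanishing on
   $U$; [c] lists its values on the unit vectors. *)
pose f x := x - projv U x.
have [j fj] : exists j, f v 0 j != 0.
  apply/existsP; apply: contraR vU; rewrite negb_exists => /forallP h.
  have /eqP : f v = 0.
    by apply/rowP => j; rewrite [RHS]mxE; apply/eqP; rewrite -[_ == _]negbK.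
  by rewrite subr_eq0 => /eqP ->; exact: memv_proj.
pose c : 'rV[F]_n := \row_s f (delta_mx 0 s) 0 j.
have cE (x : 'rV[F]_n) : \sum_s c 0 s * x 0 s = f x 0 j.
  rewrite [in RHS](row_sum_delta x) /f linear_sum -sumrB summxE.
  apply: eq_bigr => s _; rewrite linearZ -scalerBr !mxE.
  by rewrite mulrC.
exists c => [|x xU]; last by rewrite cE /f projv_id // subrr mxE.
apply: contra fj => /eqP c0; rewrite -cE c0 big1 // => s _.
by rewrite mxE mul0r.
Qed.

(** The word [c] is orthogonal to both $C$ and $F^S$; if their sum were everything, pairing [c] with
    each $e_j$ would give $c=0$. *)
Lemma dual_proper (F : finFieldType) (n : nat) (C : {vspace 'rV[F]_n})
    (S : {set 'I_n}) (c : 'rV[F]_n) :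
  c \in dual_code C -> c != 0 -> (forall s, s \in S -> c 0 s = 0) ->
  (\dim (C + coord_space F n S) < n)%N.
Proof.
move=> /mem_dual_code cC c0 cS; rewrite -[X in (_ < X)%N](dim_rowvf F).
rewrite ltn_neqAle dimvS ?subvf // andbT; apply: contra c0 => dCS.
have CSf : (C + coord_space F n S)%VS = fullv.
  by apply/eqP; rewrite eqEdim subvf (eqP dCS) leqnn.
apply/eqP/rowP => j; rewrite [RHS]mxE.
have : delta_mx 0 j \in (C + coord_space F n S)%VS by rewrite CSf memvf.
case/memv_addP => x xC [y /coord_spaceP yS jE].
have : \sum_s c 0 s * (x + y) 0 s = 0.
  rewrite -[RHS](cC x xC); apply: eq_bigr => s _; rewrite mxE.
  have [/cS -> | /yS ->] := boolP (s \in S); last by rewrite addr0.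
  by rewrite !mul0r.
rewrite -jE (bigD1 j) //= !mxE !eqxx mulr1 big1 ?addr0 // => s /negbTE sj.
by rewrite mxE sj andbF mulr0.
Qed.

Lemma exists_card_subset (T : finType) (A : {set T}) (m : nat) :
  (m <= #|A|)%N -> exists2 B : {set T}, B \subset A & #|B| = m.
Proof.
case/card_geqP => s [us <- sA]; exists [set x in s].
  by apply/subsetP => x; rewrite inE => /sA.
by rewrite cardsE; apply/card_uniqP.
Qed.

Lemma dim_cap_coord_space (F : finFieldType) (n : nat)
    (C : {vspace 'rV[F]_n}) (S : {set 'I_n}) :
  (\dim (C + coord_space F n S) + \dim (C :&: coord_space F n S)
    = \dim C + #|S|)%N.
Proof. by rewrite dimv_sum_cap dim_coord_space. Qed.

(** A generalized Singleton bound: any $S$ with $|S|=n-k+i$ satisfies $\dim(C\cap F^S)\ge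
    k+|S|-n=i$. *)
Lemma gen_weight_singleton (F : finFieldType) (n i : nat)
    (C : {vspace 'rV[F]_n}) :
  (3 <= #|F|)%N -> (i <= \dim C)%N ->
  (gen_weight C i + \dim C <= n + i)%N.
Proof.
move=> hq hi; have [_ minS] := gen_weight_coordP F n i C hq hi.
have kn : (\dim C <= n)%N by rewrite -[leqRHS](dim_rowvf F) dimvS ?subvf.
have [|S _ cS] := exists_card_subset _ [set: 'I_n] (n - \dim C + i).
  by rewrite cardsT card_ord; lia.
have dCS : (\dim (C + coord_space F n S) <= n)%N.
  by rewrite -[leqRHS](dim_rowvf F) dimvS ?subvf.
have := dim_cap_coord_space F n C S.
have := minS S; rewrite cS; lia.
Qed.

Theorem theorem8p1 (F : finFieldType) (n k i : nat) (C : {vspace 'rV[F]_n})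
    (hq : (3 <= #|F|)%N) (hk : \dim C = k) (hi : (0 <= i <= k)%N) :
  BMD C i <-> MDS C i.
Proof.
rewrite /BMD /MDS hk; have iC : (i <= \dim C)%N by rewrite hk; case/andP: hi.
have [[S gS iS] minS] := gen_weight_coordP F n i C hq iC.
have single := gen_weight_singleton F n i C hq iC.
split=> [bmd | mds].
  (* Otherwise a nonzero dual word lives off $S$, so $d^\perp\le n-|S|=n-d_i(C)$, against BMD. With
     the sum full, $i\le\dim(C\cap F^S)=k+d_i(C)-n$, the reverse of the Singleton bound. *)
  have CSf : (C + coord_space F n S)%VS = fullv.
    apply/eqP/negPn/negP => /proper_orthogonal[c c0 cU].
    have cD : c \in dual_code C.
      by apply/mem_dual_code => x xC; apply/cU/(subvP (addvSl _ _)).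
    have cS : c \in coord_space F n (~: S).
      apply/coord_spaceP => s; rewrite inE negbK => sS.
      have := cU _ (subvP (addvSr _ _) _ (delta_coord_space F n S s sS)).
      rewrite (bigD1 s) //= mxE !eqxx mulr1 big1 ?addr0 // => t /negbTE ts.
      by rewrite mxE ts andbF mulr0.
    have := min_dist_le cD c0; have := wt_coord_space F n _ c cS.
    by have := cardsC S; rewrite card_ord; lia.
  have := dim_cap_coord_space F n C S; rewrite CSf dim_rowvf; lia.
rewrite ltNge; apply/negP => nbmd.
have [D0 Dn0] := min_distP (dual_code C).
(* For a zero dual the default $d^\perp=n+1$ makes BMD automatic. *)
have [/D0 | /eqP/Dn0[[c [cD c0 wc]] _]] := eqVneq (dual_code C) 0%VS; first lia.
(* Strictness makes $n-k+i$ positive, so the predecessor taken below is a true one. *)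
have kn : (\dim C < n)%N.
  apply: leq_ltn_trans (dual_proper F n C set0 c cD c0 _); first last.
    by move=> s; rewrite inE.
  exact/dimvS/addvSl.
(* Failure of BMD leaves [c] at least $d_i(C)=n-k+i$ zeros. One fewer suffices: as $C+F^{S'}$ is
   proper, $\dim(C\cap F^{S'})\ge k+|S'|-(n-1)=i$, so $d_i(C)\le n-k+i-1$, a contradiction. *)
have [|S' sS' cS'] :=
    exists_card_subset _ (~: [set s | c 0 s != 0]) (n - k + i).-1.
  have := cardsC [set s | c 0 s != 0]; rewrite card_ord -/(wt c); lia.
have := dual_proper F n C S' c cD c0; have := dim_cap_coord_space F n C S'.
have c0S' s : s \in S' -> c 0 s = 0.
  by move/(subsetP sS'); rewrite !inE negbK => /eqP.
have := minS S'; rewrite cS' => min dimE /(_ c0S'); lia.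
Qed.
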